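(* Assume countable choice. Let $P$ be an $\omega^2$-decidable proposition. Then there exists a family $Q:\mathbb N\to\mathsf{Prop}$ of semidecidable propositions such that $P\leftrightarrow\forall n.\,Q_n$.
   Context: We work in homotopy type theory with propositional truncation. Countable choice: for every type family $B:\mathbb N\to\mathcal U$, $(\forall n.\,\|B(n)\|)\to\|\Pi(n:\mathbb N).\,B(n)\|$. A proposition $Q$ is semidecidable if $\exists (s:\mathbb N\to\mathbf 2).\,(Q\leftrightarrow\exists i.\,s_i=1)$. $\mathsf{Brw}$ is the type of Brouwer ordinals, defined as a set-truncated quotient inductive-inductive type simultaneously with a proposition-valued relation $\le$: point constructors $\mathsf{zero}$, $\mathsf{succ}$, and $\mathsf{lim}$ of strictly increasing sequences $f:\mathbb N\to\mathsf{Brw}$ ($\forall n.\,\mathsf{succ}(f_n)\le f_{n+1}$); a path constructor identifying limits of mutually simulating sequences; $\le$ is transitive, proposition-valued, with $\mathsf{zero}$ minimal, $\mathsf{succ}$ monotone, $\mathsf{lim}\,f$ the least upper bound of $f$. $\omega=\mathsf{lim}(\lambda n.\,n)$, $\omega^2=\mathsf{lim}(\lambda k.\,\omega\cdot k)$. A proposition $P$ is $\alpha$-decidable if $\exists y:\mathsf{Brw}.\,(P\leftrightarrow \alpha\le y)$. *)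

(* Defs.v *)
(* Propositions of homotopy type theory are rendered by [Prop], propositional
   truncation by [inhabited] and truncated existence by [exists].  No axiom is
   assumed. *)

Definition is_prop (A : Type) : Prop := forall a b : A, a = b.

Definition is_set (A : Type) : Prop := forall (a b : A) (p q : a = b), p = q.

Definition countable_choice : Prop :=
  forall B : nat -> Type,
    (forall n, inhabited (B n)) -> inhabited (forall n, B n).

Definition semidecidable (Q : Prop) : Prop :=
  exists s : nat -> bool, Q <-> exists i, s i = true.

(* Rocq has no quotient inductive-inductive types.  The type of Brouwer
   ordinals is therefore given by its rules: constructors ([brw_algebra]),
   premises of the dependent eliminator ([brw_methods]), and the eliminator
   with its computation rules ([brw_section], [Brw]). *)

Section Sequences.

Context {A : Type} (le : A -> A -> Prop) (succ : A -> A).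

Definition increasing (f : nat -> A) : Prop :=
  forall n, le (succ (f n)) (f (S n)).

Definition simulated_by (f g : nat -> A) : Prop :=
  forall k, exists l, le (f k) (g l).

End Sequences.

Record brw_algebra : Type := {
  carrier :> Type;
  le : carrier -> carrier -> Prop;
  zero : carrier;
  succ : carrier -> carrier;
  lim : forall f : nat -> carrier, increasing le succ f -> carrier;
  lim_bisim : forall f (hf : increasing le succ f)
                     g (hg : increasing le succ g),
    simulated_by le f g -> simulated_by le g f -> lim f hf = lim g hg;
  carrier_set : is_set carrier;
  le_zero : forall x, le zero x;
  le_trans : forall x y z, le x y -> le y z -> le x z;
  le_succ : forall x y, le x y -> le (succ x) (succ y);
  le_cocone : forall x f (hf : increasing le succ f) k,
    le x (f k) -> le x (lim f hf);
  le_limiting : forall f (hf : increasing le succ f) x,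
    (forall k, le (f k) x) -> le (lim f hf) x;
  le_prop : forall x y, is_prop (le x y)
}.

Arguments le {b} x y.
Arguments zero {b}.
Arguments succ {b} x.
Arguments lim {b} f hf.
Arguments lim_bisim {b} f hf g hg _ _.
Arguments le_zero {b} x.
Arguments le_trans {b} x y z _ _.
Arguments le_succ {b} x y _.
Arguments le_cocone {b} x f hf k _.
Arguments le_limiting {b} f hf x _.

Record brw_methods (B : brw_algebra) : Type := {
  D : B -> Type;
  R : forall x y : B, le x y -> D x -> D y -> Prop;
  d_zero : D zero;
  d_succ : forall x, D x -> D (succ x);
  d_lim : forall f (hf : increasing le succ f) (df : forall n, D (f n)),
    (forall n, R _ _ (hf n) (d_succ _ (df n)) (df (S n))) -> D (lim f hf);
  d_lim_bisim : forall f hf df dhf g hg dg dhg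
      (s : simulated_by le f g) (t : simulated_by le g f),
    (forall k, exists l (p : le (f k) (g l)), R _ _ p (df k) (dg l)) ->
    (forall k, exists l (p : le (g k) (f l)), R _ _ p (dg k) (df l)) ->
    eq_rect (lim f hf) D (d_lim f hf df dhf) (lim g hg)
            (lim_bisim f hf g hg s t)
    = d_lim g hg dg dhg;
  d_set : forall x, is_set (D x);
  d_le_zero : forall x (dx : D x), R _ _ (le_zero x) d_zero dx;
  d_le_trans : forall x y z (dx : D x) (dy : D y) (dz : D z)
      (p : le x y) (q : le y z),
    R _ _ p dx dy -> R _ _ q dy dz -> R _ _ (le_trans x y z p q) dx dz;
  d_le_succ : forall x y (dx : D x) (dy : D y) (p : le x y),
    R _ _ p dx dy ->
    R _ _ (le_succ x y p) (d_succ x dx) (d_succ y dy);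
  d_le_cocone : forall x (dx : D x) f hf df dhf k (p : le x (f k)),
    R _ _ p dx (df k) ->
    R _ _ (le_cocone x f hf k p) dx (d_lim f hf df dhf);
  d_le_limiting : forall f hf df dhf x (dx : D x) (p : forall k, le (f k) x),
    (forall k, R _ _ (p k) (df k) dx) ->
    R _ _ (le_limiting f hf x p) (d_lim f hf df dhf) dx;
  d_le_prop : forall x y p dx dy, is_prop (R x y p dx dy)
}.

Arguments D {B} b x.
Arguments R {B} b {x y} p dx dy.
Arguments d_zero {B} b.
Arguments d_succ {B} b x dx.
Arguments d_lim {B} b f hf df _.

(* In [sec_lim], [sec_le] at [hf n] is transported along [sec_succ], since the
   computation rules hold only propositionally.  Path constructors and
   constructors of the order need no computation rule: the motives are sets
   and propositions. *)
Record brw_section (B : brw_algebra) (M : brw_methods B) : Type := {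
  sec : forall x, D M x;
  sec_le : forall x y (p : le x y), R M p (sec x) (sec y);
  sec_zero : sec zero = d_zero M;
  sec_succ : forall x, sec (succ x) = d_succ M x (sec x);
  sec_lim : forall f (hf : increasing le succ f),
    sec (lim f hf) =
    d_lim M f hf (fun n => sec (f n))
      (fun n => eq_rect (sec (succ (f n)))
                        (fun a => R M (hf n) a (sec (f (S n))))
                        (sec_le _ _ (hf n)) _ (sec_succ (f n)))
}.

Arguments sec {B M} b x.

Record Brw : Type := {
  brw_alg :> brw_algebra;
  brw_elim : forall M : brw_methods brw_alg, brw_section brw_alg M
}.

Lemma is_prop_is_set (A : Type) : is_prop A -> is_set A.
Proof.
  intros h a b.
  assert (H : forall p : a = b, p = eq_trans (eq_sym (h a a)) (h a b)).
  { intros p. destruct p. destruct (h a a). reflexivity. }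
  intros p q. rewrite (H p). symmetry. apply H.
Qed.

Lemma brw_ind (B : Brw) (P : B -> Prop) (P_prop : forall x, is_prop (P x)) :
  P zero ->
  (forall x, P x -> P (succ x)) ->
  (forall f hf, (forall n, P (f n)) -> P (lim f hf)) ->
  forall x, P x.
Proof.
  intros h0 hS hL.
  refine (sec (brw_elim B (Build_brw_methods B P
    (fun _ _ _ _ _ => True) h0 hS (fun f hf df _ => hL f hf df)
    _ (fun x => is_prop_is_set _ (P_prop x)) _ _ _ _ _ _)));
    intros; try exact I.
  - apply P_prop.
  - intros [] []. reflexivity.
Qed.

Lemma le_refl (B : Brw) (x : B) : le x x.
Proof.
  revert x. apply (brw_ind B (fun x => le x x)).
  - intros x. apply le_prop.
  - apply le_zero.
  - intros x. apply le_succ.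
  - intros f hf h. apply le_limiting. intros k. apply (le_cocone _ f hf k), h.
Qed.

Section Ordinals.

Context {B : Brw}.

Fixpoint add_nat (x : B) (n : nat) : B :=
  match n with
  | O => x
  | S n => succ (add_nat x n)
  end.

Lemma add_nat_increasing (x : B) : increasing le succ (add_nat x).
Proof. intros n. apply le_refl. Qed.

(* [x + omega], by the clause [x + lim f = lim (fun n => x + f n)]. *)
Definition add_omega (x : B) : B := lim (add_nat x) (add_nat_increasing x).

Definition omega : B := lim (add_nat zero) (add_nat_increasing zero).

(* [omega * k], by [x * 0 = 0] and [x * (k + 1) = x * k + x]. *)
Fixpoint omega_mul (k : nat) : B :=
  match k with
  | O => zero
  | S k => add_omega (omega_mul k)
  end.

Lemma omega_mul_increasing : increasing le succ omega_mul.
Proof.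
  intros k. apply (le_cocone _ _ (add_nat_increasing (omega_mul k)) 1).
  apply le_refl.
Qed.

Lemma omega_mul_1 : omega_mul 1 = omega.
Proof. reflexivity. Qed.

Definition omega2 : B := lim omega_mul omega_mul_increasing.

Definition ord_decidable (a : B) (P : Prop) : Prop :=
  exists y : B, P <-> le a y.

End Ordinals.

(* Main.v *)
Require Import Defs.
From Stdlib Require Import Cantor PropExtensionality.

(** It suffices that [omega * n <= y] is semidecidable for every [n], because
    [omega^2 <= y] means [omega * n <= y] for all [n].  By induction on [y] we
    show, more generally, that [omega * n + k <= y] is semidecidable.  The case
    [y = lim f] rests on
      [omega * n + k + 1 <= lim f  <->  exists m, omega * n + k + 1 <= f m] and
      [omega * (n + 1) <= lim f  <->  exists m, omega * n <= f m],
    the second one because [f] increases, so that [omega * n <= f m] implies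
    [omega * n + k <= f (m + k)] for all [k].  Countable choice closes
    semidecidable propositions under countable unions. *)

Section Semidecidability.

Lemma semidecidable_iff (P Q : Prop) :
  (P <-> Q) -> semidecidable P -> semidecidable Q.
Proof. intros h [s hs]. exists s. tauto. Qed.

Lemma semidecidable_true (P : Prop) : P -> semidecidable P.
Proof.
  intros h. exists (fun _ => true). split; [intros _; now exists 0 | easy].
Qed.

Lemma semidecidable_false (P : Prop) : ~ P -> semidecidable P.
Proof.
  intros h. exists (fun _ => false). split; [easy | now intros [i hi]].
Qed.

(** Choice picks a sequence for every [n] at once; the Cantor pairing merges them into a single
    one. *)
Lemma semidecidable_exists (choice : countable_choice) (Q : nat -> Prop) :
  (forall n, semidecidable (Q n)) -> semidecidable (exists n, Q n).
Proof.
  intros h.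
  destruct (choice (fun n =>
    {s : nat -> bool | Q n <-> exists i, s i = true})) as [s].
  { intros n. destruct (h n) as [s hs]. constructor. now exists s. }
  exists (fun j => let (n, i) := of_nat j in proj1_sig (s n) i). split.
  - intros [n hn]. apply (proj2_sig (s n)) in hn. destruct hn as [i hi].
    exists (to_nat (n, i)). now rewrite cancel_of_to.
  - intros [j hj]. destruct (of_nat j) as [n i]. exists n.
    apply (proj2_sig (s n)). now exists i.
Qed.

End Semidecidability.

Section Inversion.

Context {B : Brw}.

(* The eliminator with motive [Prop], ordered by implication, computes
   [succ x <= y] by recursion on [y]: it is [False], [x <= y'] and
   [exists n, succ x <= f n] at [zero], [succ y'] and [lim f]. *)
Definition below_methods (x : B) : brw_methods B.
Proof.
  refine (Build_brw_methods B (fun _ => Prop) (fun _ _ _ P Q => P -> Q)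
    False (fun y _ => le x y) (fun _ _ df _ => exists n, df n)
    _ _ _ _ _ _ _ _).
  - intros f hf df dhf g hg dg dhg s t hfg hgf.
    (* Transport in a constant motive is the identity; mutual simulation then makes the two
       propositions equivalent, hence equal. *)
    transitivity (exists n, df n).
    + now destruct (lim_bisim f hf g hg s t).
    + apply propositional_extensionality. split.
      * intros [k hk]. destruct (hfg k) as [l [_ h]]. exists l. auto.
      * intros [k hk]. destruct (hgf k) as [l [_ h]]. exists l. auto.
  - intros _ P Q. apply proof_irrelevance.
  - now intros.
  - auto.
  - intros y z _ _ hyz _ hxy. exact (le_trans x y z hxy hyz).
  - intros y P f hf df dhf k _ h p. exists k. auto.
  - intros f hf df dhf y P _ h [k hk]. exact (h k hk).
  - intros. exact (proof_irrelevance _).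
Defined.

Definition below (x : B) : brw_section B (below_methods x) :=
  brw_elim B (below_methods x).

(** The section is monotone, and its value at [succ x] is [le x x], which holds. *)
Lemma below_of_le (x y : B) : le (succ x) y -> sec (below x) y.
Proof.
  intros h. refine (sec_le _ _ (below x) _ _ h _).
  rewrite sec_succ. apply le_refl.
Qed.

Lemma le_of_below (x y : B) : sec (below x) y -> le (succ x) y.
Proof.
  revert y. apply (brw_ind B (fun y => sec (below x) y -> le (succ x) y)).
  - intros y. exact (proof_irrelevance _).
  - now rewrite sec_zero.
  - intros y _. rewrite sec_succ. apply le_succ.
  - intros f hf IH. rewrite sec_lim. intros [n hn].
    apply (le_cocone _ f hf n). auto.
Qed.

Lemma not_succ_le_zero (x : B) : ~ le (succ x) zero.
Proof. intros h%below_of_le. now rewrite sec_zero in h. Qed.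

Lemma le_of_succ_le_succ (x y : B) : le (succ x) (succ y) -> le x y.
Proof. intros h%below_of_le. now rewrite sec_succ in h. Qed.

Lemma succ_le_lim (x : B) f hf :
  le (succ x) (lim f hf) <-> exists n, le (succ x) (f n).
Proof.
  split.
  - intros h%below_of_le. rewrite sec_lim in h. destruct h as [n hn].
    exists n. now apply le_of_below.
  - intros [n hn]. exact (le_cocone _ f hf n hn).
Qed.

Lemma le_lim (f : nat -> B) hf n : le (f n) (lim f hf).
Proof. apply (le_cocone _ _ _ n), le_refl. Qed.

Lemma lim_le (f : nat -> B) hf y : le (lim f hf) y <-> forall n, le (f n) y.
Proof.
  split; [| apply le_limiting].
  intros h n. exact (le_trans _ _ _ (le_lim f hf n) h).
Qed.

Lemma not_lim_le_zero (f : nat -> B) hf : ~ le (lim f hf) zero.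
Proof.
  intros h. apply (not_succ_le_zero (f 0)).
  exact (le_trans _ _ _ (hf 0) (proj1 (lim_le f hf zero) h 1)).
Qed.

Lemma le_succ_self (x : B) : le x (succ x).
Proof.
  revert x. apply (brw_ind B (fun x => le x (succ x))).
  - intros x. apply le_prop.
  - apply le_zero.
  - intros x. apply le_succ.
  - intros f hf IH. apply le_limiting. intros n.
    apply (le_trans _ _ _ (IH n)), le_succ, le_lim.
Qed.

(** Since [f] increases strictly, [succ (f n)] lies below [f (S n)], hence below [succ y], and
    [succ] cancels. *)
Lemma lim_le_succ (f : nat -> B) hf y :
  le (lim f hf) (succ y) <-> le (lim f hf) y.
Proof.
  rewrite !lim_le. split; intros h n.
  - apply le_of_succ_le_succ. exact (le_trans _ _ _ (hf n) (h (S n))).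
  - exact (le_trans _ _ _ (h n) (le_succ_self y)).
Qed.

Lemma add_nat_le_increasing (x : B) (f : nat -> B) (hf : increasing le succ f)
    (m k : nat) :
  le x (f m) -> le (add_nat x k) (f (k + m)).
Proof.
  intros h. induction k as [|k IH]; [exact h|].
  exact (le_trans _ _ _ (le_succ _ _ IH) (hf (k + m))).
Qed.

Lemma add_omega_le_lim (x : B) f hf :
  le (add_omega x) (lim f hf) <-> exists m, le x (f m).
Proof.
  unfold add_omega. rewrite lim_le. split.
  (* Term 1 of [add_nat x] is the successor [succ x], so a limit above it can be inverted. *)
  - intros h. destruct (proj1 (succ_le_lim x f hf) (h 1)) as [m hm].
    exists m. exact (le_trans _ _ _ (le_succ_self x) hm).
  - intros [m hm] k. apply (le_cocone _ _ _ (k + m)).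
    now apply add_nat_le_increasing.
Qed.

End Inversion.

(** The induction on [y] keeps [n] and [k] general: a successor [y] lowers a positive [k], and a
    limit [y] lowers a positive [n] when [k] is 0. *)
Lemma semidecidable_omega_mul_add_nat_le (B : Brw) (choice : countable_choice)
    (y : B) (n k : nat) :
  semidecidable (le (add_nat (omega_mul n) k) y).
Proof.
  revert y n k.
  apply (brw_ind B (fun y => forall n k,
    semidecidable (le (add_nat (omega_mul n) k) y))).
  - intros y. exact (proof_irrelevance _).
  - intros n [|k].
    + destruct n as [|n].
      * apply semidecidable_true, le_zero.
      * apply semidecidable_false, not_lim_le_zero.
    + apply semidecidable_false, not_succ_le_zero.
  - intros y IH n [|k].
    + destruct n as [|n].
      * apply semidecidable_true, le_zero.
      * apply (semidecidable_iff (le (omega_mul (S n)) y)), (IH (S n) 0).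
        symmetry. apply lim_le_succ.
    + apply (semidecidable_iff (le (add_nat (omega_mul n) k) y)), IH.
      split; [apply le_succ | apply le_of_succ_le_succ].
  - intros f hf IH n [|k].
    + destruct n as [|n].
      * apply semidecidable_true, le_zero.
      * apply (semidecidable_iff (exists m, le (omega_mul n) (f m))).
        -- symmetry. apply add_omega_le_lim.
        -- apply (semidecidable_exists choice). intros m. apply (IH m n 0).
    + apply (semidecidable_iff
        (exists m, le (add_nat (omega_mul n) (S k)) (f m))).
      * symmetry. apply succ_le_lim.
      * apply (semidecidable_exists choice). intros m. apply IH.
Qed.

Theorem theorem8p5 (B : Brw) (choice : countable_choice) (P : Prop)
    (hP : ord_decidable (B := B) omega2 P) :
  exists Q : nat -> Prop,
    (forall n, semidecidable (Q n)) /\ (P <-> forall n, Q n).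
Proof.
  destruct hP as [y hy]. exists (fun n => le (omega_mul n) y). split.
  - intros n. exact (semidecidable_omega_mul_add_nat_le B choice y n 0).
  - rewrite hy. apply lim_le.
Qed.
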